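(* Let $r$ be a positive integer. There exists a shape datum $(b_{\mu,\nu})_{\mu,\nu\in\mathbf{Y}}$ for $(\mathbf{Y},\leftharpoondown_r,\mathbb{N}^r)$ determined by the requirement that, for $\kappa\in\mathbf{Y}$ with $\mu\leftharpoondown_r\kappa$ and $\nu\leftharpoondown_r\kappa$, $(a,\lambda)=b_{\mu,\nu}(\kappa)$ holds if and only if $\left(\binom{\delta(\lambda)\ \delta(\mu)}{\delta(\nu)\ \delta(\kappa)},a,0\right)$ is a basic square configuration. Moreover, in that case one has $$\mathrm{spin}(\kappa/\mu)+\mathrm{spin}(\kappa/\nu)=\mathrm{spin}(\mu/\lambda)+\mathrm{spin}(\nu/\lambda)+\mathrm{n}(a).$$
   Context: $\mathbb{N}=\{0,1,2,\dots\}$. Elements of $\mathbb{N}^r$ have components indexed by $0,\dots,r-1$; for $a\in\mathbb{N}^r$ put $|a|=\sum_{i=0}^{r-1}a_i$ and $\mathrm{n}(a)=\sum_{i=0}^{r-1}i\,a_i$; $e_h$ ($0\le h<r$) is the standard basis vector with $1$ in component $h$. Bit sequences. A bit sequence is a map $s:\mathbb{Z}\to\{0,1\}$, $i\mapsto s_i$. For bit sequences $s,t$, $t/s$ is a horizontal $r$-ribbon strip, written $s\leftharpoondown_r t$, if there is a bit sequence $w$ (it is then unique, and called the witness for $s\leftharpoondown_r t$) such that for all $i\in\mathbb{Z}$, $(w_{i-r},t_{i-r},s_i,w_i)\in\{(a,a,b,b):a,b\in\{0,1\}\}\cup\{(1,0,0,1)\}$, with $(1,0,0,1)$ occurring for only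 finitely many $i$. Let $I(t/s)$ be the set of $i$ with $(w_{i-r},t_{i-r},s_i,w_i)=(1,0,0,1)$; for $i\in I(t/s)$ one says that $t/s$ has an $r$-ribbon at position $i$, of height $\sum_{j=1}^{r-1}w_{i-j}$. Put $\mathrm{spin}(t/s)=\frac12\sum_{i\in I(t/s)}\sum_{j=1}^{r-1}w_{i-j}$. Basic square configurations. Let $l,m,n,k$ be bit sequences and $a_\ll,a_\gg\in\mathbb{N}^r$. Then $\left(\binom{l\ m}{n\ k},a_\ll,a_\gg\right)$ is a basic square configuration if $m/l$, $n/l$, $k/m$, $k/n$ and $k/l$ are all horizontal $r$-ribbon strips and, with $w$ the witness for $l\leftharpoondown_r k$, there is a map $a:\mathbb{Z}\to\mathbb{N}^r$ such that for all $i\in\mathbb{Z}$, with $h=\sum_{j=1}^{r-1}w_{i-j}$: (1) if $k/l$ has no $r$-ribbon at position $i$, then $a(i)=a(i+1)$; (2) if $w_{i-r}\neq w_i$, then $a(i)_h=0$; (3) if $k/l$ has an $r$-ribbon at position $i$, then $a(i+1)=a(i)+d\,e_h$, where $d=1$ if both $m/l$ and $n/l$ have $r$-ribbons at position $i$, $d=-1$ if both $k/m$ and $k/n$ have $r$-ribbons at position $i$, and $d=0$ otherwise; (4) if $k/l$ has no $r$-ribbons at positions $j<i$, then $a(i)=a_\ll$; (5) if $k/l$ has no $r$-ribbons at positions $j\ge i$, then $a(i)=a_\gg$. Partitions. $\mathbf{Y}$ is the set of all partitions $\lambda=(\lambda_0\ge\lambda_1\ge\cdots)$ (eventually $0$),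 identified with Young diagrams; $|\lambda|=\sum_i\lambda_i$ and $|\lambda|_r=\lfloor|\lambda|/r\rfloor$. The edge sequence of $\lambda$ is the bit sequence $\delta(\lambda)$ with $\delta(\lambda)_k=1$ if and only if $k=\lambda_i-i-1$ for some $i\ge0$. For $\lambda,\mu\in\mathbf{Y}$ one writes $\lambda\leftharpoondown_r\mu$ if $\delta(\lambda)\leftharpoondown_r\delta(\mu)$, and then $\mathrm{spin}(\mu/\lambda)=\mathrm{spin}(\delta(\mu)/\delta(\lambda))$. A shape datum for $(\mathbf{Y},\leftharpoondown_r,\mathbb{N}^r)$ is a family of bijections, one for each pair $\mu,\nu\in\mathbf{Y}$, $$b_{\mu,\nu}:\{\kappa\in\mathbf{Y}:\mu\leftharpoondown_r\kappa,\ \nu\leftharpoondown_r\kappa\}\to\{(a,\lambda)\in\mathbb{N}^r\times\mathbf{Y}:\lambda\leftharpoondown_r\mu,\ \lambda\leftharpoondown_r\nu\},$$ such that $|\kappa|_r-|\nu|_r-|\mu|_r+|\lambda|_r=|a|$ whenever $(a,\lambda)=b_{\mu,\nu}(\kappa)$. *)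

(* Defs.v *)
From HB Require Import structures.
From mathcomp Require Import all_boot all_order all_algebra.
From mathcomp Require Import boolp classical_sets functions cardinality fsbigop.

Set Implicit Arguments.
Unset Strict Implicit.
Unset Printing Implicit Defensive.

Import Order.TTheory GRing.Theory Num.Theory.
Local Open Scope classical_set_scope.
Local Open Scope ring_scope.

Notation natvec r := {ffun 'I_r -> nat}.

Definition weight (r : nat) (a : natvec r) : nat := (\sum_(i < r) a i)%N.

Definition nweight (r : nat) (a : natvec r) : nat := (\sum_(i < r) i * a i)%N.

Definition bitseqZ := int -> bool.

(* The pattern (w_{i-r}, t_{i-r}, s_i, w_i) = (1, 0, 0, 1). *)
Definition ribbon_pattern (r : nat) (s t w : bitseqZ) (i : int) : bool :=
  [&& w (i - r%:Z), ~~ t (i - r%:Z), ~~ s i & w i].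

Definition is_witness (r : nat) (s t w : bitseqZ) : Prop :=
  (forall i : int, (w (i - r%:Z) = t (i - r%:Z) /\ s i = w i) \/
                   ribbon_pattern r s t w i) /\
  finite_set [set i | ribbon_pattern r s t w i].

Definition hstrip (r : nat) (s t : bitseqZ) : Prop :=
  exists w, is_witness r s t w.

(* For r > 0 a witness is unique when it exists, so that the choice is
   immaterial; the default value is only returned when [hstrip r s t] fails. *)
Definition witness (r : nat) (s t : bitseqZ) : bitseqZ :=
  xget (fun=> false) [set w | is_witness r s t w].

Definition ribbon_at (r : nat) (s t : bitseqZ) (i : int) : bool :=
  ribbon_pattern r s t (witness r s t) i.

Definition height (r : nat) (w : bitseqZ) (i : int) : nat :=
  (\sum_(1 <= j < r) w (i - j%:Z)%R)%N.

Definition spin (r : nat) (s t : bitseqZ) : rat :=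
  2%:R^-1 * \sum_(i \in [set i | ribbon_at r s t i])
              ((height r (witness r s t) i)%:R : rat).

Definition ribbon_step (r : nat) (l m n k : bitseqZ) (i : int) : int :=
  if ribbon_at r l m i && ribbon_at r l n i then 1
  else if ribbon_at r m k i && ribbon_at r n k i then -1
  else 0.

(* For r > 0 one has [height r w i < r], so that the quantification over
   [h : 'I_r] equal to the height ranges over exactly one index. *)
Definition basic_square_labelling (r : nat) (l m n k : bitseqZ)
    (a_ll a_gg : natvec r) (a : int -> natvec r) : Prop :=
  let w := witness r l k in
  forall i : int,
  [/\ ~~ ribbon_at r l k i -> a i = a (i + 1),
      w (i - r%:Z) != w i ->
        forall h : 'I_r, h = height r w i :> nat -> a i h = 0%N,
      ribbon_at r l k i ->
        forall h : 'I_r, h = height r w i :> nat ->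
        forall c : 'I_r, (a (i + 1) c)%:Z =
          (a i c)%:Z + ribbon_step r l m n k i * (c == h)%:Z,
      (forall j : int, j < i -> ~~ ribbon_at r l k j) -> a i = a_ll
    & (forall j : int, i <= j -> ~~ ribbon_at r l k j) -> a i = a_gg].

Definition basic_square (r : nat) (l m n k : bitseqZ)
    (a_ll a_gg : natvec r) : Prop :=
  [/\ hstrip r l m, hstrip r l n, hstrip r m k, hstrip r n k & hstrip r l k] /\
  exists a : int -> natvec r, basic_square_labelling l m n k a_ll a_gg a.

(* A partition is represented by the list of its nonzero parts; part number i
   (counted from 0) of [p] is [nth 0%N p i]. *)
Record ypartition := YPartition {
  parts :> seq nat;
  ypartitionP : sorted geq parts && (0%N \notin parts)
}.

HB.instance Definition _ := [isSub for parts].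
HB.instance Definition _ := [Choice of ypartition by <:].

Definition psize (r : nat) (p : ypartition) : nat := (sumn p %/ r)%N.

Definition edge (p : ypartition) : bitseqZ :=
  fun k => `[< exists i : nat, k = (nth 0%N p i)%:Z - i%:Z - 1 >].

Definition pstrip (r : nat) (p q : ypartition) : Prop :=
  hstrip r (edge p) (edge q).

Definition pspin (r : nat) (p q : ypartition) : rat :=
  spin r (edge p) (edge q).

Definition above (r : nat) (mu nu : ypartition) : set ypartition :=
  [set kappa | pstrip r mu kappa /\ pstrip r nu kappa].

Definition below (r : nat) (mu nu : ypartition) : set (natvec r * ypartition) :=
  [set al | pstrip r al.2 mu /\ pstrip r al.2 nu].
Arguments below : clear implicits.

(* The sets [above r mu nu] and [below r mu nu] are used as subtypes. *)
Definition shape_map (r : nat) :=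
  forall mu nu : ypartition, above r mu nu -> below r mu nu.

Definition is_shape_datum (r : nat) (b : shape_map r) : Prop :=
  (forall mu nu, bijective (b mu nu)) /\
  (forall mu nu (kappa : above r mu nu) (a : natvec r) (lambda : ypartition),
    \val (b mu nu kappa) = (a, lambda) ->
    (psize r (\val kappa))%:Z - (psize r nu)%:Z - (psize r mu)%:Z
      + (psize r lambda)%:Z = (weight a)%:Z).

Definition square_rule (r : nat) (b : shape_map r) : Prop :=
  forall mu nu (kappa : above r mu nu) (a : natvec r) (lambda : ypartition),
    \val (b mu nu kappa) = (a, lambda) <->
    basic_square (edge lambda) (edge mu) (edge nu) (edge (\val kappa)) a 0.

(* Main.v *)
Require Import Defs.
From mathcomp Require Import all_boot all_order all_algebra.
From mathcomp Require Import boolp classical_sets functions cardinality fsbigop.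
From mathcomp Require Import zify ring.

(* Horizontal strips are encoded by their sets of ribbons: [m = l + M - M(. + r)]
   with [M] finite. In a basic square the witness [l + K] of [k/l] and the
   labels [a(i)] can be computed from left to right out of [l], [m], [n] and
   [a_ll], each ribbon of [k/l] being forced, so [k] and [a_gg] exist and are
   unique; for edge sequences the windows far to the right contain no ones,
   hence [a_gg = 0]. Reversing [Z] exchanges [l] with [k] and [a_ll] with
   [a_gg], so that the same computation recovers [(a_ll, l)] from [k] and
   [a_gg = 0]. The size and spin formulas follow by telescoping the sums of
   [a(i)_c] and [c a(i)_c] over [i]. *)

Set Implicit Arguments.
Unset Strict Implicit.
Unset Printing Implicit Defensive.

Import Order.TTheory GRing.Theory Num.Theory.
Local Open Scope ring_scope.

(** The delicate point is condition (2) where $w_{i-r}=0$ and $w_i=1$: no ribbon is to be decided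
    there, so the vanishing of the label at that height has to come from the past. It does if the
    label always vanishes at the heights not below the number of ones among the $r$ bits before $i$.
    Far to the left of an edge sequence that number is $r$, so $a_\ll$ is unrestricted; far to the
    right it is $0$, which leaves only $a_\gg=0$. The reversed computation starts from the label
    $0$, for which the requirement is void whatever the bits are; so a single construction serves
    both directions, and its uniqueness makes the two resulting maps inverse to each other. *)

Definition supported_in (B : nat) (I : bitseqZ) : Prop :=
  forall i : int, I i -> - B%:Z <= i < B%:Z.

Lemma supported_in_le (B C : nat) (I : bitseqZ) :
  (B <= C)%N -> supported_in B I -> supported_in C I.
Proof. by move=> leBC supI i /supI; lia. Qed.

Lemma finite_set_supported (I : bitseqZ) :
  finite_set [set i | I i]%classic <-> exists B, supported_in B I.
Proof.
split.
  move=> /finite_seqP[s Is]; exists (\sum_(i <- s) `|i|.+1)%N => i Ii.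
  have : i \in s by have : [set` s]%classic i by rewrite -Is.
  move=> si; rewrite (big_rem i) //=; lia.
case=> B supI; apply: (@sub_finite_set _ _
  [set` [seq n%:Z - B%:Z | n <- iota 0 (2 * B)]]%classic); last first.
  exact: finite_seq.
move=> i /= /supI Bi; apply/mapP; exists (absz (i + B%:Z)); last by lia.
by rewrite mem_iota; lia.
Qed.

(** * Induction and recursion along $\mathbb{Z}$ from left to right *)

Lemma causal_ind (B : int) (P : int -> Prop) :
  (forall i, i < B -> P i) ->
  (forall i, B <= i -> (forall j, j < i -> P j) -> P i) ->
  forall i, P i.
Proof.
move=> Pl Pi; suff PB n : forall i, i < B + n%:Z -> P i.
  by move=> i; apply: (PB `|i - B|.+1%N); lia.
elim: n => [i ltiB|n IHn i ltin]; first by apply: Pl; lia.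
have [/Pl//|leBi] := ltrP i B.
by apply: Pi => // j ltji; apply: IHn; lia.
Qed.

(** Iterating [Phi] from the constant [d], the iterate [F n] is already final at the positions below
    [B + n], since each value depends only on values further left. The solution is read off
    diagonally. *)
Lemma causal_rec (T : Type) (d : T) (B : int) (Phi : (int -> T) -> int -> T) :
  (forall f g i, (forall j, j < i -> f j = g j) -> Phi f i = Phi g i) ->
  exists f, (forall i, i < B -> f i = d) /\
            (forall i, B <= i -> f i = Phi f i).
Proof.
move=> PhiE.
pose F := fix F n : int -> T := if n is n'.+1 then
    fun i => if i < B then d else Phi (F n') i
  else fun=> d.
have Fst n m i : i < B + n%:Z -> (n <= m)%N -> F m i = F n i.
  elim: n m i => [|n IHn] [|m] i //= ltin lenm; first by rewrite ifT //; lia.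
  case: ifP => // /negbT; rewrite -leNgt => leBi; apply: PhiE => j ltji.
  by apply: IHn; lia.
exists (fun i => F `|i - B|.+1%N i); split=> i ltiB /=; first by rewrite ltiB.
rewrite ifF; last by lia.
apply: PhiE => j ltji; case: (ltrP j B) => [ltjB|leBj].
  by case: (absz _) => //= n; rewrite ltjB.
by rewrite (Fst `|j - B|.+1%N) /= ?ifF //; lia.
Qed.

(* The ribbons of a horizontal strip move ones of [s] to the right by [r]:
   both sides of the equation are the bit of the witness at [i]. *)
Definition strip (r : nat) (s t I : bitseqZ) : Prop :=
  forall i, (t i + I (i + r%:Z)%R = s i + I i)%N /\ (s i + I i <= 1)%N.

(** * Horizontal strips and their witnesses *)

Section Strip.
Variable r : nat.
Implicit Types s t u w I J K : bitseqZ.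

Lemma strip_witness s t I : finite_set [set i | I i]%classic -> strip r s t I ->
  is_witness r s t (fun i => s i || I i) /\
  ribbon_pattern r s t (fun i => s i || I i) = I.
Proof.
move=> finI stI.
have patE : ribbon_pattern r s t (fun i => s i || I i) = I.
  apply: funext => i; rewrite /ribbon_pattern.
  have := stI (i - r%:Z); have := stI i; rewrite subrK.
  by case: (I i); case: (s i); case: (s (i - _)); case: (I (i - _));
     case: (t (i - _)) => //=; lia.
split=> //; split; last by rewrite patE.
move=> i; rewrite patE.
have := stI (i - r%:Z); have := stI i; rewrite subrK.
by case: (I i); case: (s i); case: (s (i - _)); case: (I (i - _));
     case: (t (i - _)) => //=; auto; lia.
Qed.

Lemma witness_strip s t w : is_witness r s t w ->
  strip r s t (ribbon_pattern r s t w) /\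
  w = (fun i => s i || ribbon_pattern r s t w i).
Proof.
case=> wP _; split.
  move=> i; have := wP i; have := wP (i + r%:Z); rewrite /ribbon_pattern addrK.
  case: (w i); case: (t i); case: (s i); case: (w (i + _)); case: (s (i + _));
  case: (w (i - _)); case: (t (i - _)) => //=; by [split | lia].
apply: funext => i; have := wP i; rewrite /ribbon_pattern.
case: (w i); case: (t (i - _)); case: (s i); case: (w (i - _)) => //=; lia.
Qed.

Lemma hstripP s t :
  hstrip r s t <-> exists I, finite_set [set i | I i]%classic /\ strip r s t I.
Proof.
split=> [[w ww]|[I [finI stI]]].
  by exists (ribbon_pattern r s t w); case: (witness_strip ww); case: ww.
by exists (fun i => s i || I i); case: (strip_witness finI stI).
Qed.

(** Subtract the equation of [I] from that of [K]; the inclusion makes the difference $K-I$ a set of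
    positions. *)
Lemma strip_complement s t u I K : (forall i, I i -> K i) ->
  strip r s t I -> strip r s u K -> strip r t u (fun i => K i && ~~ I i).
Proof.
move=> IK stI suK i; have := stI i; have := suK i.
move: (IK i) (IK (i + r%:Z)).
by case: (I i); case: (K i); case: (I (_ + _)); case: (K (_ + _)) => //=; lia.
Qed.

Variable hr : (0 < r)%N.

(** The equation at [i - r] gives [I i] from [I (i - r)], and far to the left there is no ribbon. *)
Lemma strip_inj s t I J : finite_set [set i | I i]%classic ->
  finite_set [set i | J i]%classic -> strip r s t I -> strip r s t J -> I = J.
Proof.
move=> /finite_set_supported[B supI] /finite_set_supported[C supJ] stI stJ.
apply: funext; apply: (@causal_ind (- (B + C)%:Z)) => [i lti|i _ IHi].
  have /negP/negPf-> : ~ I i by move=> /supI; lia.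
  by have /negP/negPf-> : ~ J i by move=> /supJ; lia.
have := stI (i - r%:Z); have := stJ (i - r%:Z); rewrite subrK.
by rewrite (IHi (i - r%:Z)); [case: (I i); case: (J i); lia | lia].
Qed.

Lemma strip_witnessE s t I : finite_set [set i | I i]%classic -> strip r s t I ->
  witness r s t = (fun i => s i || I i) /\ ribbon_at r s t = I.
Proof.
move=> finI stI; have [ww patE] := strip_witness finI stI.
suff wE : witness r s t = (fun i => s i || I i).
  by split=> //; apply: funext => i; rewrite /ribbon_at wE patE.
rewrite /witness; case: xgetP => [w _ ww'|/(_ _ ww)//].
have [stw ->] := witness_strip ww'.
by rewrite (strip_inj _ finI stw stI) //; case: ww'.
Qed.

(** $I+J-K$ is $r$-periodic by the three equations and vanishes far to the left. So the ribbons of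
    $u/s$ are those of $t/s$ together with those of $u/t$, without overlap. *)
Lemma strip_trans s t u I J K :
  finite_set [set i | I i]%classic -> finite_set [set i | J i]%classic ->
  finite_set [set i | K i]%classic ->
  strip r s t I -> strip r t u J -> strip r s u K ->
  forall i, nat_of_bool (K i) = (I i + J i)%N.
Proof.
move=> /finite_set_supported[B supI] /finite_set_supported[C supJ].
move=> /finite_set_supported[D supK] stI tuJ suK.
apply: (@causal_ind (- (B + C + D)%:Z)) => [i lti|i _ IHi].
  have /negP/negPf-> : ~ I i by move=> /supI; lia.
  have /negP/negPf-> : ~ K i by move=> /supK; lia.
  by have /negP/negPf-> : ~ J i by move=> /supJ; lia.
have := stI (i - r%:Z); have := tuJ (i - r%:Z); have := suK (i - r%:Z).
rewrite subrK.
by have := IHi (i - r%:Z) ltac:(lia); lia.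
Qed.

End Strip.

(** * Ones in the window before a position *)

Section Height.
Variable r : nat.
Implicit Type w : bitseqZ.

(** The height at [i] is the part common to the windows before [i] and before [i + 1]: the former
    adds the bit at [i - r], the latter the bit at [i]. *)
Definition ones w (i : int) : nat := (\sum_(1 <= j < r.+1) w (i - j%:Z)%R)%N.

Lemma ones_height w i : (0 < r)%N ->
  ones w i = (height r w i + w (i - r%:Z)%R)%N.
Proof. by move=> hr; rewrite /ones big_nat_recr. Qed.

Lemma ones_succ w i : (0 < r)%N -> ones w (i + 1) = (w i + height r w i)%N.
Proof.
move=> hr; rewrite /ones big_nat_recl //=; congr (nat_of_bool (w _) + _)%N.
  by lia.
rewrite /height -[in RHS](prednK hr).
by rewrite -[in LHS](prednK hr); apply: eq_bigr => j _; congr (nat_of_bool (w _)); lia.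
Qed.

Lemma height_ltn w i : (0 < r)%N -> (height r w i < r)%N.
Proof.
move=> hr; suff : (height r w i <= \sum_(1 <= j < r) 1)%N.
  by rewrite sum_nat_const_nat muln1; lia.
by apply: leq_sum => j _; case: (w _).
Qed.

Lemma eq_height w w' i : (forall j, j < i -> w j = w' j) ->
  height r w i = height r w' i.
Proof.
by move=> ww'; apply: eq_big_nat => j /andP[j0 _]; rewrite ww' //; lia.
Qed.

Lemma eq_ones w w' i : (forall j, j < i -> w j = w' j) -> ones w i = ones w' i.
Proof.
by move=> ww'; apply: eq_big_nat => j /andP[j0 _]; rewrite ww' //; lia.
Qed.

End Height.

Definition bitor (s I : bitseqZ) : bitseqZ := fun i => s i || I i.

(* A basic square configuration given by its ribbon positions: [M], [N], [K]
   are those of [m/l], [n/l], [k/l]; those of [k/m] and [k/n] are then [K \ M]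
   and [K \ N], so that the increment [d] of the labelling is [M + N - K]. *)
Record square (r : nat) (l m n k M N K : bitseqZ) (a : int -> natvec r) : Prop :=
  Square {
    square_lm : strip r l m M;
    square_ln : strip r l n N;
    square_lk : strip r l k K;
    square_MK : forall i, M i -> K i;
    square_NK : forall i, N i -> K i;
    square_step : forall i (c : 'I_r),
      let h := height r (bitor l K) i in
      (a (i + 1)%R c + (c == h :> nat) * K i =
       a i c + (c == h :> nat) * (M i + N i))%N;
    square_zero : forall i (c : 'I_r),
      bitor l K (i - r%:Z) != bitor l K i ->
      c = height r (bitor l K) i :> nat -> a i c = 0%N
  }.

Lemma strip_ribbon r s t I i : strip r s t I -> I i ->
  ~~ s i && bitor s I (i - r%:Z).
Proof.
move=> stI; have := stI (i - r%:Z); have := stI i; rewrite subrK /bitor.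
by case: (I i); case: (s i); case: (s (i - _)); case: (I (i - _)) => //=; lia.
Qed.

(** * The local rule, uniqueness and conservation laws of squares *)

Section Square.
Variables (r : nat) (hr : (0 < r)%N).
Implicit Types (l m n k M N K : bitseqZ) (a : int -> natvec r).

(** If $w_{i-r}=1$, $l_i=0$ and there is no ribbon, then $w_i=0$ and condition (2) makes the label
    zero at this height. Conversely a ribbon outside [M] and [N] lowers that label by one, so it was
    positive. *)
Lemma square_rule_ribbon l m n k M N K a i (c : 'I_r) :
  square l m n k M N K a -> c = height r (bitor l K) i :> nat ->
  K i = [&& bitor l K (i - r%:Z), ~~ l i & [|| M i, N i | (0 < a i c)%N]].
Proof.
move=> sq ch.
have := square_step sq i c; have := square_zero sq (i := i) (c := c).
have := square_lk sq (i - r%:Z); have := square_lk sq i.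
have := square_MK sq (i := i); have := square_NK sq (i := i).
rewrite subrK /= -ch eqxx /bitor !mul1n.
case: (K i); case: (l i); case: (l (i - _)); case: (K (i - _)) => //=;
  case: (M i); case: (N i) => //=; lia.
Qed.

Lemma square_inj l m n k k' M N K K' a a' (B : int) :
  square l m n k M N K a -> square l m n k' M N K' a' ->
  (forall i, i < B -> K i = K' i /\ a i = a' i) ->
  [/\ K = K', a = a' & k = k'].
Proof.
move=> sq sq' left.
have KaE : forall i, K i = K' i /\ a i = a' i.
  apply: (causal_ind left) => i _ IHi.
  have wE j : j < i -> bitor l K j = bitor l K' j.
    by move=> /IHi[+ _]; rewrite /bitor => ->.
  have aE : a i = a' i.
    apply/ffunP => c; have [KE aE] := IHi (i - 1) ltac:(lia).
    have := square_step sq (i - 1) c; have := square_step sq' (i - 1) c.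
    rewrite subrK -KE -aE /= (@eq_height _ (bitor l K') (bitor l K)).
      by lia.
    by move=> j ltji; rewrite wE //; lia.
  split=> //.
  pose c := Ordinal (height_ltn (bitor l K) i hr).
  rewrite (square_rule_ribbon (c := c) sq) //.
  rewrite (square_rule_ribbon (c := c) sq') ?aE ?wE //; first by lia.
  exact: eq_height.
have KE : K = K' by apply: funext => i; case: (KaE i).
split=> //; first by apply: funext => i; case: (KaE i).
apply: funext => i.
have := square_lk sq i; have := square_lk sq' i; rewrite -KE.
by case: (k i); case: (k' i); lia.
Qed.

Lemma square_complement l m n k M N K a :
  square l m n k M N K a ->
  strip r m k (fun i => K i && ~~ M i) /\ strip r n k (fun i => K i && ~~ N i).
Proof.
move=> sq; split.
  exact: strip_complement (fun i => square_MK sq (i := i))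
    (square_lm sq) (square_lk sq).
exact: strip_complement (fun i => square_NK sq (i := i))
  (square_ln sq) (square_lk sq).
Qed.

(** Only the component at the height changes. The weights $g=1$ and $g(c)=c$ yield $|a|$ and
    $\mathrm{n}(a)$. *)
Lemma square_moment l m n k M N K a i (g : nat -> nat) :
  square l m n k M N K a ->
  (\sum_(c < r) g c * a (i + 1)%R c + g (height r (bitor l K) i) * K i =
   \sum_(c < r) g c * a i c + g (height r (bitor l K) i) * (M i + N i))%N.
Proof.
move=> sq; set h := height _ _ _.
have sum_h (x : nat) : (\sum_(c < r) g c * ((c == h :> nat) * x) = g h * x)%N.
  rewrite (bigD1 (Ordinal (height_ltn (bitor l K) i hr))) //= eqxx mul1n.
  rewrite big1 ?addn0 // => c /eqP ch; case: eqP; last by rewrite muln0.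
  by move=> e; case: ch; apply: val_inj.
rewrite -!sum_h -!big_split /=; apply: eq_bigr => c _.
by rewrite -!mulnDr; congr muln; exact: square_step sq i c.
Qed.

Lemma square_weight l m n k M N K a i : square l m n k M N K a ->
  (weight (a (i + 1)%R) + K i = weight (a i) + M i + N i)%N.
Proof.
move=> /(@square_moment _ _ _ _ _ _ _ _ i (fun=> 1%N)).
have wE (x : natvec r) : (\sum_(c < r) 1 * x c)%N = weight x.
  by apply: eq_bigr => c _; rewrite mul1n.
by rewrite !wE !mul1n addnA.
Qed.

Lemma square_const l m n k M N K a (i j : int) :
  square l m n k M N K a -> i <= j ->
  (forall x, i <= x < j -> ~~ K x) -> a i = a j.
Proof.
move=> sq leij; rewrite (_ : j = i + `|j - i|%N%:Z); last by lia.
elim: `|j - i|%N => [|p IHp] noK; first by rewrite addr0.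
rewrite IHp; last by move=> x xi; apply: noK; lia.
apply/ffunP => c; have := square_step sq (i + p%:Z) c.
have -> : i + p%:Z + 1 = i + p.+1%:Z by lia.
have := noK (i + p%:Z) ltac:(lia).
have := square_MK sq (i := i + p%:Z); have := square_NK sq (i := i + p%:Z).
by case: (K _); case: (M _); case: (N _) => //=; lia.
Qed.

End Square.

(** * Existence of squares, from left to right *)

Section Forward.
Variables (r : nat) (hr : (0 < r)%N).
Implicit Types (l m n k M N K : bitseqZ) (a : int -> natvec r).

(* Each ribbon of [k/l] off [M] and [N] uses up one unit of the label, so there
   are finitely many of them. *)
Lemma square_eventually_no_ribbon l m n k M N K a (C : int) :
  square l m n k M N K a -> (forall i, C <= i -> ~~ M i /\ ~~ N i) ->
  exists D, forall i, D <= i -> ~~ K i.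
Proof.
move=> sq noMN.
have [w] := ubnP (weight (a C)); elim: w C noMN => // w IHw C noMN aw.
have [noK|/existsNP[i /not_implyP[Ci /negP/negPn Ki]]] :=
  pselect (forall i, C <= i -> ~~ K i); first by exists C.
apply: (IHw (i + 1)) => [j ij|]; first by apply: noMN; lia.
have antiw p : (weight (a (C + p%:Z)%R) <= weight (a C))%N.
  elim: p => [|p IHp]; first by rewrite addr0.
  have := square_weight hr (C + p%:Z) sq; have := noMN (C + p%:Z) ltac:(lia).
  have -> : C + p%:Z + 1 = C + p.+1%:Z by lia.
  by lia.
have := antiw `|i - C|%N; have -> : C + `|i - C|%N%:Z = i by lia.
have := square_weight hr i sq; have [/negPf-> /negPf->] := noMN i Ci.
by rewrite Ki /= !addn0 addn1 => <- /leq_trans; apply; exact: aw.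
Qed.

(* The bits of [k] are determined from left to right: a bit [1] at [i - r] must
   move to a vacant position [i] if it does so in [m] or [n], and otherwise
   moves iff the label allows it. That condition (2) holds in the remaining
   cases follows from the invariant that the label vanishes at all heights
   at least the number of ones in the window of length [r] before [i]. *)
Lemma square_forward l m n M N (a0 : natvec r) (B : int) :
  strip r l m M -> strip r l n N ->
  finite_set [set i | M i]%classic -> finite_set [set i | N i]%classic ->
  (forall i (c : 'I_r), i <= B -> (ones r l i <= c)%N -> a0 c = 0%N) ->
  exists k K a, [/\ square l m n k M N K a, finite_set [set i | K i]%classic,
    (exists D, forall i, i <= D -> a i = a0),
    (exists g D, forall i, D <= i -> a i = g) &
    forall i (c : 'I_r), (ones r (bitor l K) i <= c)%N -> a i c = 0%N].
Proof.
move=> lmM lnN /finite_set_supported[C supM] /finite_set_supported[D supN] inv0.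
(* Lowering [B] only weakens the requirement on [a0], so [B] may be taken to the left of all ribbons
   in [M] and [N]. *)
wlog BCD : B inv0 / B <= - (C + D)%:Z.
  move=> wl; apply: (wl (Num.min B (- (C + D)%:Z))); last by lia.
  by move=> i c iB; apply: inv0; lia.
have noM i : i < B -> M i = false by move=> iB; apply/negP => /supM; lia.
have noN i : i < B -> N i = false by move=> iB; apply/negP => /supN; lia.
(* The state at [i] is the pair of [K i] and the label at [i + 1]; hence the label at [i] is read
   from the state at [i - 1]. *)
pose Phi (f : int -> bool * natvec r) (i : int) :=
  let w j := l j || (f j).1 in
  let a := (f (i - 1)).2 in
  let h := height r w i in
  let Ki := [&& w (i - r%:Z), ~~ l i & [|| M i, N i |
     [exists c : 'I_r, (c == h :> nat) && (0 < a c)%N]]] in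
  (Ki, [ffun c => a c + (c == h :> nat) * (M i + N i) - (c == h :> nat) * Ki]%N).
have [] := @causal_rec _ (false, a0) B Phi.
  move=> f g i fg; rewrite /Phi (fg (i - 1)) ?(fg (i - r%:Z)); try lia.
  rewrite (@eq_height r (fun j => l j || (f j).1) (fun j => l j || (g j).1)) //.
  by move=> j ji; rewrite fg.
move=> f [fl fr].
pose K i := (f i).1; pose a i := (f (i - 1)).2; pose w := bitor l K.
have Kl i : i < B -> K i = false by move=> iB; rewrite /K fl.
have al i : i <= B -> a i = a0 by move=> iB; rewrite /a fl //; lia.
have Kr i (c : 'I_r) : B <= i -> c = height r w i :> nat ->
    K i = [&& w (i - r%:Z), ~~ l i & [|| M i, N i | (0 < a i c)%N]].
  move=> Bi ch; rewrite /K fr //= -/(a i) -/(w _).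
  congr (_ && (_ && (_ || (_ || _)))).
  apply/existsP/idP => [[c' /andP[/eqP c'h]]|ac].
    by rewrite (_ : c = c') //; apply: val_inj; rewrite /= ch c'h.
  by exists c; rewrite ac andbT; apply/eqP.
(* The one that a ribbon of [M] at [i] moves comes from [l] or from [M] at [i - r], and in the
   latter case from [K] by induction; the same holds for [N]. *)
have MNK i : (M i -> K i) /\ (N i -> K i).
  move: i; apply: (@causal_ind B) => [i iB|i Bi IHi]; first by rewrite noM // noN.
  rewrite (Kr i (Ordinal (height_ltn w i hr))) //.
  have [MKr NKr] := IHi (i - r%:Z) ltac:(lia); rewrite /w /bitor.
  split=> [Mi|Ni].
    have /andP[-> /orP[->|/MKr->]] := strip_ribbon lmM Mi;
    by rewrite Mi ?orbT.
  have /andP[-> /orP[->|/NKr->]] := strip_ribbon lnN Ni;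
  by rewrite Ni ?orbT.
(* The truncated subtraction in [Phi] is exact: a ribbon outside [M] and [N] occurs only when the
   label at its height is positive. *)
have step i (c : 'I_r) : let h := height r w i in
    (a (i + 1)%R c + (c == h :> nat) * K i =
     a i c + (c == h :> nat) * (M i + N i))%N.
  have [iB|Bi] /= := ltrP i B.
    by rewrite noM // noN // Kl // !al //; lia.
  have -> : a (i + 1) c = (a i c + (c == height r w i :> nat) * (M i + N i)
      - (c == height r w i :> nat) * K i)%N.
    by rewrite {1}/a addrK /K fr //= ffunE.
  have [ch|] := eqVneq (c : nat) (height r w i); last by lia.
  have := Kr i c Bi ch; case: (K i); last by lia.
  by case: (M i); case: (N i) => //=; lia.
have stepE i (c : 'I_r) : (c : nat) <> height r w i -> a (i + 1) c = a i c.
  by move=> /eqP/negPf ch; have := step i c; rewrite /= ch !mul0n !addn0.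
(* From [i - 1] to [i] the only index that can become newly constrained is the height at [i - 1],
   when a one leaves the window and none enters. Then no ribbon was placed, so the rule gives label
   zero there. *)
have inv : forall i (c : 'I_r), (ones r w i <= c)%N -> a i c = 0%N.
  apply: (@causal_ind (B + 1)) => [i iB c|i Bi IHi c].
    rewrite (@eq_ones _ w l) => [wc|j ji]; last by rewrite /w /bitor Kl ?orbF //; lia.
    by rewrite al ?(inv0 i) //; lia.
  have iE : i = i - 1 + 1 by rewrite subrK.
  rewrite {1 2}iE ones_succ // => wc.
  have IH := IHi (i - 1) ltac:(lia) c; rewrite ones_height // in IH.
  have [ch|ch] := eqVneq (c : nat) (height r w (i - 1)); last first.
    by rewrite stepE; [apply: IH; case: (w (_ - _)); lia | apply/eqP].
  have := Kr (i - 1) c ltac:(lia) ch; have := step (i - 1) c.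
  have [MK NK] := MNK (i - 1); rewrite /= -ch eqxx !mul1n.
  have : ~~ w (i - 1) by case: (w _) wc => //; lia.
  rewrite {1}/w /bitor negb_or => /andP[/negPf -> /negPf Kf].
  rewrite Kf in MK NK *; case: (M _) MK => [/(_ isT)//|_].
  case: (N _) NK => [/(_ isT)//|_] /=; rewrite subrK.
  by case: (w _) IH => //=; lia.
have Kw i : K i -> w (i - r%:Z) && ~~ l i.
  have [iB|Bi] := ltrP i B; first by rewrite Kl.
  by rewrite (Kr i (Ordinal (height_ltn w i hr))) // => /and3P[-> ->].
pose k i := w i && ~~ K (i + r%:Z).
have sq : square l m n k M N K a.
  split=> // [i|i /(MNK i).1//|i /(MNK i).2//|i c wi ch].
    have := Kw (i + r%:Z); have := Kw i; rewrite /k addrK /w /bitor.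
    by case: (K i); case: (K (i + _)); case: (l i) => //=; lia.
  (* Condition (2): if $w_{i-r}=0$, the window before [i] has exactly [c] ones and the invariant
     applies at [i]. If $w_{i-r}=1$ and $w_i=0$, it applies at [i + 1], and the label does not
     change at [i]. *)
  case wr: (w (i - r%:Z)); last by apply: inv; rewrite ones_height // wr ch addn0.
  have := inv (i + 1) c; rewrite ones_succ //; move: wi; rewrite -/w wr.
  case wi: (w i) => // _; rewrite add0n ch => /(_ (leqnn _)).
  have := step i c; rewrite /=; have [MK NK] := MNK i.
  move/negbT: wi; rewrite {1}/w /bitor negb_or => /andP[_ /negPf Kf].
  rewrite Kf in MK NK *; case: (M _) MK => [/(_ isT)//|_].
  by case: (N _) NK => [/(_ isT)//|_] /=; rewrite muln0 !addn0 => ->.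
have [|E noK] := square_eventually_no_ribbon (C := (C + D)%:Z) sq.
  by move=> i iCD; split; apply/negP; [move/supM|move/supN]; lia.
exists k, K, a; split=> //.
- apply/finite_set_supported; exists (`|E| + `|B|)%N => i Ki.
  have : ~ E <= i by move=> /noK; rewrite Ki.
  have : ~ i < B by move=> /Kl; rewrite Ki.
  lia.
- by exists B.
- exists (a E), E => i Ei; rewrite (square_const hr sq Ei) //.
  by move=> x /andP[Ex _]; exact: noK.
Qed.

End Forward.

(** * Reversal, and agreement with the definition of basic squares *)

Section BasicSquare.
Variable r : nat.
Implicit Types (l m n k s t w I M N K : bitseqZ) (a : int -> natvec r).

Lemma sub_finite_ribbons I K : (forall i, I i -> K i) ->
  finite_set [set i | K i]%classic -> finite_set [set i | I i]%classic.
Proof. by move=> IK; apply: sub_finite_set => i /=; exact: IK. Qed.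

Definition refl s : bitseqZ := fun i => s (- i).

Lemma reflK s : refl (refl s) = s.
Proof. by apply: funext => i; rewrite /refl opprK. Qed.

(** A ribbon at [i] moves a one from [i - r] to [i]; in the reversed strip the move goes from [- i]
    to [r - i]. *)
Lemma strip_refl s t I :
  strip r s t I -> strip r (refl t) (refl s) (fun i => I (r%:Z - i)).
Proof.
move=> stI i; have := stI (- i); rewrite /refl.
have -> : r%:Z - (i + r%:Z) = - i by lia.
have -> : - i + r%:Z = r%:Z - i by lia.
lia.
Qed.

Lemma height_refl w i : height r (refl w) i = height r w (r%:Z - i).
Proof.
rewrite /height big_nat_rev /=; apply: eq_big_nat => j jr; congr (nat_of_bool (w _)).
by lia.
Qed.

(* Reversal of [Z] exchanges [l] with [k] and [a_ll] with [a_gg]. *)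
Lemma square_refl l m n k M N K a : square l m n k M N K a ->
  square (refl k) (refl m) (refl n) (refl l)
    (fun i => K (r%:Z - i) && ~~ M (r%:Z - i))
    (fun i => K (r%:Z - i) && ~~ N (r%:Z - i))
    (fun i => K (r%:Z - i)) (fun i => a (r%:Z - i + 1)).
Proof.
move=> sq; have [mk nk] := square_complement sq.
(* Both sides of the strip equation at [- i] are the bit of the witness, so the witness of the
   reversed strip is the reversed witness. *)
have wE : bitor (refl k) (fun i => K (r%:Z - i)) = refl (bitor l K).
  apply: funext => i; rewrite /bitor /refl; have := square_lk sq (- i).
  have -> : - i + r%:Z = r%:Z - i by lia.
  by case: (k _); case: (K (r%:Z - i)); case: (l _); case: (K _) => //=; lia.
split.
- exact: (strip_refl mk).
- exact: (strip_refl nk).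
- exact: strip_refl (square_lk sq).
- by move=> i /andP[].
- by move=> i /andP[].
- move=> i c; rewrite wE height_refl /=.
  have -> : r%:Z - (i + 1) + 1 = r%:Z - i by lia.
  have := square_step sq (r%:Z - i) c; rewrite /=.
  have := square_MK sq (i := r%:Z - i); have := square_NK sq (i := r%:Z - i).
  by case: (_ == _); case: (M _); case: (N _); case: (K _) => //=; lia.
(* The label wanted lies to the right of position [r - i], while condition (2) of the given square
   concerns the one to its left. They agree, since unequal bits exclude a ribbon at [r - i]. *)
- move=> i c; rewrite wE height_refl /refl.
  have -> : - (i - r%:Z) = r%:Z - i by lia.
  move=> wi ch; have := square_zero sq (i := r%:Z - i) (c := c).
  have riE : r%:Z - i - r%:Z = - i by lia.
  rewrite riE eq_sym => /(_ wi ch) a0.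
  have := square_step sq (r%:Z - i) c.
  have := square_MK sq (i := r%:Z - i); have := square_NK sq (i := r%:Z - i).
  have -> /= : K (r%:Z - i) = false.
    apply/negP => Ki; have /andP[_] := strip_ribbon (square_lk sq) Ki.
    by move: wi; rewrite riE {1}/bitor Ki orbT; case: (bitor _ _ _).
  by rewrite a0; case: (M _); case: (N _) => //=; lia.
Qed.

Lemma finite_refl (I : bitseqZ) (c : int) : finite_set [set i | I i]%classic ->
  finite_set [set i | I (c - i)]%classic.
Proof.
move=> /finite_set_supported[B supI]; apply/finite_set_supported.
by exists (`|c| + B).+1%N => i /supI; lia.
Qed.

Variable hr : (0 < r)%N.

(** Conditions (4) and (5) become constancy of the labels far out, because [K] is finite and labels
    change only at ribbons. *)
Lemma basic_squareP l m n k (a_ll a_gg : natvec r) :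
  basic_square l m n k a_ll a_gg <->
  exists M N K a, [/\ square l m n k M N K a, finite_set [set i | K i]%classic,
    (exists D, forall i, i <= D -> a i = a_ll) &
    (exists D, forall i, D <= i -> a i = a_gg)].
Proof.
split.
  case=> -[/hstripP sM /hstripP sN /hstripP sM' /hstripP sN' /hstripP sK].
  case: sM sN sM' sN' sK => [M [finM lmM]] [N [finN lnN]] [M' [finM' mkM']].
  move=> [N' [finN' nkN']] [K [finK lkK]] [a lab].
  have KM := strip_trans hr finM finM' finK lmM mkM' lkK.
  have KN := strip_trans hr finN finN' finK lnN nkN' lkK.
  move: lab; rewrite /basic_square_labelling /ribbon_step.
  rewrite (strip_witnessE hr finK lkK).1 (strip_witnessE hr finK lkK).2.
  rewrite (strip_witnessE hr finM lmM).2 (strip_witnessE hr finN lnN).2.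
  rewrite (strip_witnessE hr finM' mkM').2 (strip_witnessE hr finN' nkN').2.
  move=> /= lab; exists M, N, K, a.
  have /finite_set_supported[B supK] := finK.
  split=> //.
  - split=> // [i|i|i c|i c wi ch].
    + by have := KM i; case: (K i); case: (M i).
    + by have := KN i; case: (K i); case: (N i).
    + have [noK _ yesK _ _] := lab i; have := KM i; have := KN i.
      have [Ki|nKi] := boolP (K i); last first.
        by rewrite (noK nKi); case: (M i); case: (N i) => //=; lia.
      have := yesK Ki (Ordinal (height_ltn (bitor l K) i hr)) erefl c.
      rewrite -val_eqE /= -/(bitor l K); case: (_ == height _ _ _);
      case: (M i); case: (N i); case: (M' i); case: (N' i) => //=; lia.
    + by have [_ + _ _ _] := lab i; move=> /(_ wi c ch).
  - exists (- B%:Z) => i iB; have [_ _ _ + _] := lab i; apply=> j ji.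
    by apply/negP => /supK; lia.
  - exists B%:Z => i iB; have [_ _ _ _ +] := lab i; apply=> j ji.
    by apply/negP => /supK; lia.
case=> M [N [K [a [sq finK [D aD] [E aE]]]]].
have MK i : M i -> K i by move/(square_MK sq).
have NK i : N i -> K i by move/(square_NK sq).
have finM := sub_finite_ribbons MK finK.
have finN := sub_finite_ribbons NK finK.
have finM' : finite_set [set i | K i && ~~ M i]%classic.
  by apply: sub_finite_ribbons finK => i /andP[].
have finN' : finite_set [set i | K i && ~~ N i]%classic.
  by apply: sub_finite_ribbons finK => i /andP[].
have [mk nk] := square_complement sq.
have [lm ln lk _ _ step zero] := sq.
split.
  split; apply/hstripP.
  - by exists M.
  - by exists N.
  - by exists (fun i => K i && ~~ M i).
  - by exists (fun i => K i && ~~ N i).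
  - by exists K.
exists a; rewrite /basic_square_labelling /ribbon_step.
rewrite (strip_witnessE hr finK lk).1 (strip_witnessE hr finK lk).2.
rewrite (strip_witnessE hr finM lm).2 (strip_witnessE hr finN ln).2.
rewrite (strip_witnessE hr finM' mk).2 (strip_witnessE hr finN' nk).2.
move=> /= i; split=> [nKi|wi c ch|Ki c' ch c|noK|noK].
- apply: (square_const hr sq); first by lia.
  by move=> x ix; rewrite (_ : x = i) //; lia.
- exact: zero wi ch.
- have := step i c; rewrite -val_eqE /= -/(bitor l K) -ch Ki.
  by case: (_ == _); case: (M i); case: (N i) => //=; lia.
- rewrite -(aD (Num.min i D)); last by lia.
  apply: esym; apply: (square_const hr sq); first by lia.
  by move=> x xi; apply: noK; lia.
- rewrite -(aE (Num.max i E)); last by lia.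
  apply: (square_const hr sq); first by lia.
  by move=> x xi; apply: noK; lia.
Qed.

End BasicSquare.

(** * Sums over a finite window *)

Section WindowSum.
Variable V : zmodType.
Implicit Types (f g : int -> V) (B : nat).

(** The window is $[-B,B)$, in which the edge sequence of the empty partition has exactly $B$
    ones. *)
Definition wsum B f : V := \sum_(0 <= j < 2 * B) f (j%:Z - B%:Z).

Lemma eq_wsum B f g : (forall i, - B%:Z <= i < B%:Z -> f i = g i) ->
  wsum B f = wsum B g.
Proof.
move=> fg; apply: eq_big_nat => j jB; apply: fg; lia.
Qed.

Lemma wsumD B f g : wsum B (fun i => f i + g i) = wsum B f + wsum B g.
Proof. exact: big_split. Qed.

Lemma wsumB B f g : wsum B (fun i => f i - g i) = wsum B f - wsum B g.
Proof. exact: sumrB. Qed.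

Lemma wsum_exchange B (J : Type) (s : seq J) (F : J -> int -> V) :
  wsum B (fun i => \sum_(j <- s) F j i) = \sum_(j <- s) wsum B (F j).
Proof. exact: exchange_big. Qed.

Lemma wsum_telescope B f : wsum B (fun i => f (i + 1) - f i) = f B%:Z - f (- B%:Z).
Proof.
rewrite /wsum; pose u j := f (j%:Z - B%:Z).
rewrite (eq_bigr (fun j => u j.+1 - u j)).
  rewrite telescope_sumr // /u; congr (f _ - f _); lia.
by move=> j _; congr (f _ - f _); lia.
Qed.

Lemma wsum_shift B (c : nat) f : (forall i, B%:Z <= i -> f i = 0) ->
  (forall i, i < - B%:Z + c%:Z -> f i = 0) ->
  wsum B (fun i => f (i + c%:Z)) = wsum B f.
Proof.
move=> fr; elim: c => [|c IHc] fl.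
  by apply: eq_wsum => i _; rewrite addr0.
rewrite -IHc; last by move=> i ic; apply: fl; lia.
apply/eqP; rewrite -subr_eq0 -wsumB.
rewrite (@eq_wsum _ _ (fun i => f ((i + 1) + c%:Z) - f (i + c%:Z))).
  rewrite (wsum_telescope B (fun i => f (i + c%:Z))) fr ?fl ?subrr //; lia.
by move=> i _; congr (f _ - _); lia.
Qed.

End WindowSum.

(** * Edge sequences of partitions *)

Lemma parts_anti (p : ypartition) (i j : nat) :
  (i <= j)%N -> (nth 0 p j <= nth 0 p i)%N.
Proof.
move=> ij; have /andP[ps _] := ypartitionP p.
have [jp|pj] := ltnP j (size p); last by rewrite (nth_default _ pj).
have geq_tr : transitive geq by move=> x y z /= xy yz; exact: leq_trans yz xy.
by apply: (sorted_leq_nth geq_tr (fun x => leqnn x) 0%N ps) => //; rewrite ?inE; lia.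
Qed.

Lemma nth_parts_gt0 (p : ypartition) (i : nat) :
  (0 < nth 0 p i)%N = (i < size p)%N.
Proof.
have [ip|pi] := ltnP i (size p); last by rewrite nth_default.
have /andP[_] := ypartitionP p; apply: contraR; rewrite -eqn0Ngt => /eqP <-.
exact: mem_nth.
Qed.

Lemma eq_parts (p q : ypartition) : (forall i, nth 0%N p i = nth 0%N q i) -> p = q.
Proof.
move=> pq; apply: val_inj; apply: (@eq_from_nth _ 0%N) => [|i _]; last exact: pq.
apply/eqP; rewrite eqn_leq; apply/andP; split; rewrite leqNgt -nth_parts_gt0.
  by rewrite pq nth_default.
by rewrite -pq nth_default.
Qed.

Lemma edgeP (p : ypartition) (k : int) :
  reflect (exists i : nat, k = (nth 0%N p i)%:Z - i%:Z - 1) (edge p k).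
Proof. exact: asboolP. Qed.

Lemma edge_part (p : ypartition) (i : nat) : edge p ((nth 0%N p i)%:Z - i%:Z - 1).
Proof. by apply/edgeP; exists i. Qed.

(** Ones are met from right to left at decreasing positions. If the parts before [i] agree, the one
    of part [i] of [p] is a one of [q] of index at least [i], whence $p_i\le q_i$; exchange [p] and
    [q]. *)
Lemma edge_inj : injective edge.
Proof.
have part_le p q i : edge p = edge q ->
    (forall j, (j < i)%N -> nth 0%N p j = nth 0%N q j) ->
    (nth 0%N p i <= nth 0%N q i)%N.
  move=> pq pqi; have := edge_part p i; rewrite pq => /edgeP[j].
  have [ji|ij] := ltnP j i; last by have := parts_anti q ij; lia.
  by have := parts_anti p (ltnW ji); rewrite -pqi //; lia.
move=> p q pq; apply: eq_parts => i; elim/ltn_ind: i => i IHi.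
apply/eqP; rewrite eqn_leq !part_le // => j /IHi //.
Qed.

Lemma edge_left (p : ypartition) (k : int) : k < - (size p)%:Z -> edge p k.
Proof. by move=> kp; apply/edgeP; exists `|- k - 1|%N; rewrite nth_default; lia. Qed.

Lemma edge_right (p : ypartition) (k : int) : (nth 0%N p 0)%:Z <= k -> ~~ edge p k.
Proof.
by move=> pk; apply/negP => /edgeP[i]; have := parts_anti p (leq0n i); lia.
Qed.

Definition edge_bound (p : ypartition) : nat := (size p + nth 0 p 0)%N.

(** The ones in the window are those of the parts of index below [B]: any later part is zero and
    puts its one to the left of [- B]. *)
Lemma wsum_edge (p : ypartition) (B : nat) (F : int -> int) :
  (edge_bound p <= B)%N ->
  wsum B (fun k => F k *+ edge p k) =
  \sum_(0 <= i < B) F ((nth 0%N p i)%:Z - i%:Z - 1).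
Proof.
rewrite /edge_bound => pB.
pose h i := absz ((nth 0%N p i)%:Z - i%:Z - 1 + B%:Z).
rewrite /wsum (eq_bigr (fun j =>
  if edge p (j%:Z - B%:Z) then F (j%:Z - B%:Z) else 0)); last first.
  by move=> j _; rewrite mulrb.
rewrite -big_mkcond -big_filter.
have hE i : (i < B)%N -> (h i)%:Z = (nth 0%N p i)%:Z - i%:Z - 1 + B%:Z.
  by rewrite /h; lia.
have hperm : perm_eq [seq j <- index_iota 0 (2 * B) | edge p (j%:Z - B%:Z)]
    [seq h i | i <- index_iota 0 B].
  apply: uniq_perm.
  - by rewrite filter_uniq // iota_uniq.
  - rewrite map_inj_in_uniq ?iota_uniq // => i j; rewrite !mem_index_iota => iB jB hij.
    have := hE i iB; have := hE j jB; rewrite hij => ->.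
    have [ij|/ltnW ji] := leqP i j; first by have := parts_anti p ij; lia.
    by have := parts_anti p ji; lia.
  - move=> j; rewrite mem_filter mem_index_iota; apply/andP/mapP.
      case=> /edgeP[i ji] jB; exists i; last by rewrite /h -ji; lia.
      rewrite mem_index_iota.
      have [|Bi] := ltnP i B; first by lia.
      by rewrite nth_default in ji; lia.
    case=> i; rewrite mem_index_iota => iB ->; rewrite hE // addrK edge_part.
    split=> //; have := hE i iB; have := parts_anti p (leq0n i); lia.
rewrite (perm_big _ hperm) big_map; apply: eq_big_nat => i iB.
by rewrite hE ?addrK.
Qed.

(** This count singles out the edge sequences among the sequences that are 1 far to the left and 0
    far to the right; [edge_surj] is the converse. *)
Lemma wsum_edge_charge (p : ypartition) (B : nat) : (edge_bound p <= B)%N ->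
  wsum B (fun k => (edge p k : nat)%:Z) = B%:Z.
Proof.
move=> pB; rewrite (eq_wsum (g := fun k => 1 *+ edge p k)) => [|k _].
  by rewrite wsum_edge // sumr_const_nat subn0 natz.
by case: (edge p k).
Qed.

Lemma wsum_edge_size (p : ypartition) (B : nat) : (edge_bound p <= B)%N ->
  wsum B (fun k => k *+ edge p k) =
  (sumn p)%:Z - \sum_(0 <= i < B) (i%:Z + 1).
Proof.
move=> pB; rewrite wsum_edge //; apply/eqP; rewrite eq_sym subr_eq -big_split /=.
rewrite (eq_bigr (fun i => (nth 0%N p i)%:R)) => [|i _]; last by rewrite natz; lia.
rewrite -natr_sum natz; apply/eqP; congr (_%:Z).
rewrite sumnE (big_nth 0%N) (@big_cat_nat _ _ _ (size p) 0 B) //=.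
  rewrite -[LHS]addn0; congr addn; rewrite big_nat big1 // => i /andP[pi _].
  by rewrite nth_default.
by move: pB; rewrite /edge_bound; lia.
Qed.

Lemma nth_filter_gt0 (q : seq nat) (i : nat) : sorted geq q ->
  nth 0%N [seq x <- q | (0 < x)%N] i = nth 0%N q i.
Proof.
have geq_tr : transitive geq by move=> x y z /= xy yz; exact: leq_trans yz xy.
elim: q i => [|x q IHq] i //= xq; have qs := path_sorted xq.
have [x0|] := posnP x; last by case: i => //= i; rewrite IHq.
have qx y : y \in q -> y = 0%N.
  by move=> yq; have /allP/(_ y yq) := order_path_min geq_tr xq; rewrite /= x0; lia.
rewrite (_ : [seq y <- q | _] = [::]); last first.
  by apply/eqP; rewrite -[_ == _]negbK -has_filter -all_predC; apply/allP => y /qx ->.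
rewrite nth_nil; case: i => [|i] /=; first by rewrite x0.
have [iq|qi] := ltnP i (size q); last by rewrite nth_default.
by rewrite (qx _ (mem_nth _ iq)).
Qed.

(* The ones of [s] in the window are at the positions [u_j - B] with [u]
   increasing, and give the parts [u_j - j], listed in reverse. *)
Lemma edge_surj (s : bitseqZ) (B : nat) :
  (forall i, i < - B%:Z -> s i) -> (forall i, B%:Z <= i -> ~~ s i) ->
  wsum B (fun k => (s k : nat)%:Z) = B%:Z -> exists p, edge p = s.
Proof.
move=> sl sr sB.
pose u := [seq j <- iota 0 (2 * B) | s (j%:Z - B%:Z)].
have us : sorted ltn u.
  by apply: sorted_filter; [exact: ltn_trans | exact: iota_ltn_sorted].
have uB : size u = B.
  apply/eqP; rewrite -eqz_nat -sB /wsum size_filter -sum1_count /index_iota subn0.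
  rewrite big_mkcond /= -natz natr_sum; apply/eqP; apply: eq_bigr => j _.
  by case: (s _).
have u_mono i j : (i <= j < B)%N -> (nth 0 u i + (j - i) <= nth 0 u j)%N.
  case/andP=> ij jB; elim: j ij jB => [|j IHj] ij jB.
    by rewrite (_ : i = 0%N) ?addn0 //; lia.
  have [->|ij'] := eqVneq i j.+1; first by rewrite subnn addn0.
  have := IHj ltac:(lia) ltac:(lia).
  have := sorted_ltn_nth ltn_trans 0%N us j j.+1; rewrite !inE uB.
  by move=> /(_ ltac:(lia) jB (ltnSn _)); lia.
pose q := mkseq (fun i => nth 0 u (B - i.+1) - (B - i.+1))%N B.
have qi i : (i < B)%N -> nth 0%N q i = (nth 0 u (B - i.+1) - (B - i.+1))%N.
  by move=> iB; rewrite nth_mkseq.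
have u_ge j : (j < B)%N -> (j <= nth 0 u j)%N.
  by move=> jB; have := @u_mono 0%N j ltac:(lia); lia.
have qs : sorted geq q.
  apply/(sortedP 0%N) => i; rewrite size_mkseq => iB; rewrite !qi /=; try lia.
  have := @u_mono (B - i.+2)%N (B - i.+1)%N ltac:(lia).
  by have := u_ge (B - i.+2)%N ltac:(lia); lia.
have pP : sorted geq [seq x <- q | (0 < x)%N] && (0%N \notin [seq x <- q | (0 < x)%N]).
  rewrite sorted_filter //; first by rewrite mem_filter.
  by move=> x y z /= xy yz; exact: leq_trans yz xy.
exists (YPartition pP); apply: funext => k; apply/edgeP/idP => /= [[i]|sk].
  rewrite nth_filter_gt0 // => ->; have [iB|Bi] := ltnP i B; last first.
    by rewrite nth_default ?size_mkseq //; apply: sl; lia.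
  rewrite qi //; have := u_ge (B - i.+1)%N ltac:(lia).
  have : nth 0%N u (B - i.+1) \in u by rewrite mem_nth // uB; lia.
  rewrite mem_filter => /andP[su _] ug; apply: etrans su; congr s; lia.
have [kB|Bk] := ltrP k (- B%:Z).
  exists `|- k - 1|%N; rewrite nth_filter_gt0 // nth_default ?size_mkseq; lia.
have kB : k < B%:Z by rewrite ltNge; apply/negP => /sr; rewrite sk.
pose x := absz (k + B%:Z).
have xu : x \in u by rewrite mem_filter mem_iota (_ : x%:Z - _ = k) ?sk; lia.
have xB : (index x u < B)%N by rewrite -uB index_mem.
exists (B - (index x u).+1)%N; rewrite nth_filter_gt0 // qi; last by lia.
have -> : (B - (B - (index x u).+1).+1 = index x u)%N by lia.
by have := u_ge _ xB; rewrite nth_index //; lia.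
Qed.

(** * Conservation of charge and growth of size along a strip *)

Section StripSums.
Variables (r : nat) (s t I : bitseqZ) (C B : nat).
Hypotheses (stI : strip r s t I) (supI : supported_in C I) (CB : (C + r <= B)%N).

Lemma strip_out i : ~~ (- B%:Z <= i < B%:Z) -> s i = t i.
Proof.
move=> iB; have := stI i.
have /negP/negPf -> : ~ I i by move=> /supI; lia.
have /negP/negPf -> : ~ I (i + r%:Z) by move=> /supI; lia.
by case: (s i); case: (t i) => //=; lia.
Qed.

Lemma strip_wsum_shift (F : int -> int) :
  wsum B (fun i => F (i + r%:Z) *+ I (i + r%:Z)) = wsum B (fun i => F i *+ I i).
Proof.
apply: (wsum_shift (f := fun i => F i *+ I i)) => i iB.
  have /negP/negPf -> // : ~ I i by move=> /supI; lia.
have /negP/negPf -> // : ~ I i by move=> /supI; lia.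
Qed.

Lemma strip_charge :
  wsum B (fun i => (t i : nat)%:Z) = wsum B (fun i => (s i : nat)%:Z).
Proof.
apply/eqP; rewrite eq_sym -subr_eq0 -wsumB.
have := strip_wsum_shift (fun=> 1); move/eqP; rewrite -subr_eq0 -wsumB => /eqP <-.
apply/eqP/eq_wsum => i _; have [] := stI i.
by case: (I i); case: (I (_ + _)) => /=; lia.
Qed.

Lemma strip_size : wsum B (fun i => i *+ t i) =
  wsum B (fun i => i *+ s i) + r%:Z * wsum B (fun i => (I i : nat)%:Z).
Proof.
(* The strip equation multiplied by [i] and summed, with $i=(i+r)-r$ in the shifted term. *)
have E : wsum B (fun i => i *+ t i) +
    wsum B (fun i => (i + r%:Z) *+ I (i + r%:Z)) =
    wsum B (fun i => i *+ s i) + wsum B (fun i => i *+ I i) +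
    wsum B (fun i => r%:Z *+ I (i + r%:Z)).
  rewrite -!wsumD; apply: eq_wsum => i _; have [] := stI i.
  by case: (I i); case: (I (_ + _)); case: (s i); case: (t i) => //=; lia.
move: E; rewrite (strip_wsum_shift id) (strip_wsum_shift (fun=> r%:Z)).
rewrite (@eq_wsum _ _ (fun i => r%:Z *+ I i) (fun i => r%:Z * (I i : nat)%:Z)).
  rewrite {5}/wsum -mulr_sumr -/(wsum B _) => E.
  by apply: (addIr (wsum B (fun i => i *+ I i))); rewrite E addrAC.
by move=> i _; case: (I i); lia.
Qed.

End StripSums.

(** * Strips between partitions *)

Section EdgeStrip.
Variable r : nat.
Implicit Types (s t I : bitseqZ) (p q : ypartition).

(** Finitely many moves of ones alter neither the two ends of the sequence nor its charge. *)
Lemma edge_strip_right p t I : finite_set [set i | I i]%classic ->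
  strip r (edge p) t I -> exists q, edge q = t.
Proof.
move=> /finite_set_supported[C supI] stI; pose B := (C + r + edge_bound p)%N.
have CB : (C + r <= B)%N by rewrite /B leq_addr.
have pB : (edge_bound p <= B)%N by rewrite /B leq_addl.
have out := strip_out stI supI CB.
apply: (@edge_surj _ B) => [i iB|i Bi|].
- by rewrite -out ?edge_left //; move: pB; rewrite /edge_bound; lia.
- by rewrite -out ?edge_right //; move: pB; rewrite /edge_bound; lia.
- by rewrite (strip_charge stI supI CB) wsum_edge_charge.
Qed.

Lemma edge_strip_left s q I : finite_set [set i | I i]%classic ->
  strip r s (edge q) I -> exists p, edge p = s.
Proof.
move=> /finite_set_supported[C supI] stI; pose B := (C + r + edge_bound q)%N.
have CB : (C + r <= B)%N by rewrite /B leq_addr.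
have qB : (edge_bound q <= B)%N by rewrite /B leq_addl.
have out := strip_out stI supI CB.
apply: (@edge_surj _ B) => [i iB|i Bi|].
- by rewrite out ?edge_left //; move: qB; rewrite /edge_bound; lia.
- by rewrite out ?edge_right //; move: qB; rewrite /edge_bound; lia.
- by rewrite -(strip_charge stI supI CB) wsum_edge_charge.
Qed.

Variable hr : (0 < r)%N.

(** Each ribbon adds exactly $r$ to the size, so the rounded quotient grows by the number of
    ribbons. *)
Lemma psize_strip p q I (C B : nat) :
  strip r (edge p) (edge q) I -> supported_in C I ->
  (C + r + edge_bound p + edge_bound q <= B)%N ->
  (psize r q)%:Z = (psize r p)%:Z + wsum B (fun i => (I i : nat)%:Z).
Proof.
move=> stI supI CB; have := strip_size stI supI (B := B) ltac:(lia).
rewrite !wsum_edge_size; try lia.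
have : 0 <= wsum B (fun i => (I i : nat)%:Z) by apply: sumr_ge0.
case: (wsum _ _) => // n _ E.
have -> : psize r q = (n + psize r p)%N.
  by rewrite /psize -divnMDl //; congr (_ %/ _)%N; lia.
by lia.
Qed.

Lemma spin_wsum s t I (B : nat) : strip r s t I -> supported_in B I ->
  spin r s t =
  2%:R^-1 * wsum B (fun i => (height r (bitor s I) i)%:R *+ I i : rat).
Proof.
move=> stI supI.
have finI : finite_set [set i | I i]%classic by apply/finite_set_supported; exists B.
rewrite /spin (strip_witnessE hr finI stI).1 (strip_witnessE hr finI stI).2.
congr (_ * _); rewrite -/(bitor s I).
rewrite -(@bigfs _ _ _ _ [seq j%:Z - B%:Z | j <- iota 0 (2 * B)]).
- rewrite big_map big_mkcond /wsum /index_iota subn0.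
  by apply: eq_bigr => j _; rewrite mulrb.
- by rewrite map_inj_uniq ?iota_uniq // => i j; lia.
- move=> i Ii /mapP[]; exists (absz (i + B%:Z)); last by have := supI i Ii; lia.
  by rewrite mem_iota; have := supI i Ii; lia.
Qed.

End EdgeStrip.

(** * Spin differences and moments of the labels *)

Section Spin.
Variables (r : nat) (hr : (0 < r)%N).
Implicit Types (l m n k I M N K : bitseqZ) (a : int -> natvec r).

(* The witnesses of [m/l] and [k/m] differ from that of [k/l] by the ribbons
   of [k/m] and [m/l]; the two resulting corrections to the spin cancel, since
   both count the pairs of a ribbon of [m/l] and one of [k/m] at a distance
   less than [r] to its left. *)
Lemma spin_complement l m k M K (C B : nat) :
  strip r l m M -> strip r l k K -> (forall i, M i -> K i) ->
  supported_in C K -> (C + r <= B)%N ->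
  spin r m k - spin r l m = 2%:R^-1 * wsum B (fun i =>
    (height r (bitor l K) i)%:R * ((K i : nat)%:R - (M i : nat)%:R *+ 2) : rat).
Proof.
move=> lmM lkK MK supK CB; have mkM' := strip_complement MK lmM lkK.
set M' := fun i => K i && ~~ M i in mkM'.
have supM : supported_in C M by move=> i /MK /supK.
have supM' : supported_in C M' by move=> i /andP[/supK].
have CB' : (C <= B)%N by lia.
rewrite (spin_wsum hr lmM (supported_in_le CB' supM)).
rewrite (spin_wsum hr mkM' (supported_in_le CB' supM')).
rewrite -mulrBr; congr (_ * _); set w := bitor l K.
have wm i : (bitor m M' i + M (i + r%:Z)%R = w i)%N.
  rewrite /w /bitor /M'; have := lmM i; have := lkK i.
  have := MK i; have := MK (i + r%:Z); by case: (M i); case: (K i); case: (l i); case: (m i); case: (M (_ + _));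
    case: (K (_ + _)) => //=; lia.
have wl i : (bitor l M i + M' i = w i)%N.
  rewrite /w /bitor /M'; have := lkK i; have := MK i.
  by case: (M i); case: (K i); case: (l i) => //=; lia.
(* The correction is a sum of $M_{i-j+r}$; replacing $j$ by $r-j$ turns it into one over the
   positions $i+j$. *)
have hm i : (height r (bitor m M') i)%:R =
    (height r w i)%:R - \sum_(1 <= j < r) (M (i + j%:Z) : nat)%:R :> rat.
  apply/eqP; rewrite eq_sym subr_eq -natr_sum -natrD eqr_nat; apply/eqP.
  rewrite [in RHS]big_nat_rev /= -big_split /=; apply: eq_big_nat => j jr.
  by rewrite -wm; congr (_ + nat_of_bool (M _))%N; lia.
have hl i : (height r (bitor l M) i)%:R =
    (height r w i)%:R - \sum_(1 <= j < r) (M' (i - j%:Z) : nat)%:R :> rat.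
  apply/eqP; rewrite eq_sym subr_eq -natr_sum -natrD eqr_nat; apply/eqP.
  by rewrite -big_split /=; apply: eq_big_nat => j jr; rewrite -wl.
pose F j i : rat := (M' (i - j%:Z) && M i)%:R.
have corr : wsum B (fun i => \sum_(1 <= j < r) F j (i + j%:Z)) =
            wsum B (fun i => \sum_(1 <= j < r) F j i).
  rewrite !wsum_exchange; apply: eq_big_nat => j jr; apply: wsum_shift => i iB.
    rewrite /F; have /negP/negPf -> : ~ M i by move=> /supM; lia.
    by rewrite andbF.
  rewrite /F; have /negP/negPf -> : ~ M i by move=> /supM; lia.
  by rewrite andbF.
rewrite -wsumB; apply/eqP; rewrite -subr_eq0.
move/eqP: corr; rewrite eq_sym -subr_eq0 -wsumB => /eqP <-; rewrite -wsumB.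
apply/eqP/eq_wsum => i _; rewrite hm hl /F.
have -> : \sum_(1 <= j < r) (M' (i + j%:Z - j%:Z) && M (i + j%:Z))%:R =
  (\sum_(1 <= j < r) (M (i + j%:Z) : nat)%:R) *+ M' i :> rat.
  rewrite -sumrMnl; apply: eq_bigr => j _; rewrite addrK.
  by case: (M' i); case: (M _).
have -> : \sum_(1 <= j < r) (M' (i - j%:Z) && M i)%:R =
  (\sum_(1 <= j < r) (M' (i - j%:Z) : nat)%:R) *+ M i :> rat.
  by rewrite -sumrMnl; apply: eq_bigr => j _; case: (M i); case: (M' _).
(* What remains is $M'-M=K-2M$, valid as [M] lies in [K]. *)
move: (\sum_(_ <= _ < _) _) (\sum_(_ <= _ < _) _) => x y.
rewrite /M'; have := MK i.
by case: (M i) => [/(_ isT) ->|_] /=; [ring | case: (K i) => /=; ring].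
Qed.

Lemma square_moment_wsum l m n k M N K a (a_ll a_gg : natvec r) (B : nat)
    (g : nat -> nat) :
  square l m n k M N K a -> a (- B%:Z) = a_ll -> a B%:Z = a_gg ->
  wsum B (fun i => (g (height r (bitor l K) i))%:Z *
    ((K i : nat)%:Z - (M i : nat)%:Z - (N i : nat)%:Z)) =
  (\sum_(c < r) g c * a_ll c)%N%:Z - (\sum_(c < r) g c * a_gg c)%N%:Z.
Proof.
move=> sq <- <-.
have := wsum_telescope B (fun i => - (\sum_(c < r) g c * a i c)%N%:Z).
rewrite opprK addrC => <-; apply: eq_wsum => i _.
have := square_moment hr i g sq; move: (g _) => x.
move: (\sum_(c < r) _)%N (\sum_(c < r) _)%N => y z.
by case: (K i); case: (M i); case: (N i) => /=; lia.
Qed.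

End Spin.

(** * Basic squares of partitions *)

Section ShapeDatum.
Variables (r : nat) (hr : (0 < r)%N).
Implicit Types (l m n k M N K : bitseqZ) (a a_ll a_gg : natvec r).
Implicit Types lambda mu nu kappa : ypartition.

Lemma basic_square_refl l m n k a_ll a_gg :
  basic_square l m n k a_ll a_gg ->
  basic_square (refl k) (refl m) (refl n) (refl l) a_gg a_ll.
Proof.
move=> /(basic_squareP hr)[M [N [K [a [sq finK [D aD] [E aE]]]]]].
apply/(basic_squareP hr); exists (fun i => K (r%:Z - i) && ~~ M (r%:Z - i)).
exists (fun i => K (r%:Z - i) && ~~ N (r%:Z - i)), (fun i => K (r%:Z - i)).
exists (fun i => a (r%:Z - i + 1)); split; first exact: square_refl.
- exact: finite_refl.
- by exists (r%:Z + 1 - E) => i iE /=; apply: aE; lia.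
- by exists (r%:Z + 1 - D) => i iD /=; apply: aD; lia.
Qed.

Lemma basic_square_right_inj l m n k k' a_ll a_gg a_gg' :
  basic_square l m n k a_ll a_gg -> basic_square l m n k' a_ll a_gg' ->
  k = k' /\ a_gg = a_gg'.
Proof.
move=> /(basic_squareP hr)[M [N [K [a [sq finK [D aD] [E aE]]]]]].
move=> /(basic_squareP hr)[M' [N' [K' [a' [sq' finK' [D' aD'] [E' aE']]]]]].
have MM : M' = M.
  apply: (strip_inj hr _ _ (square_lm sq') (square_lm sq)).
    by apply: sub_finite_ribbons finK' => i /(square_MK sq').
  by apply: sub_finite_ribbons finK => i /(square_MK sq).
have NN : N' = N.
  apply: (strip_inj hr _ _ (square_ln sq') (square_ln sq)).
    by apply: sub_finite_ribbons finK' => i /(square_NK sq').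
  by apply: sub_finite_ribbons finK => i /(square_NK sq).
rewrite MM NN in sq'.
have /finite_set_supported[B supK] := finK.
have /finite_set_supported[B' supK'] := finK'.
have [i iB|_ aa' kk'] := square_inj hr
    (B := Num.min (Num.min D D') (- (B + B')%:Z)) sq sq'; last first.
  split=> //; rewrite -(aE (Num.max E E')) ?aa' ?aE' //; lia.
split; last by rewrite aD ?aD' //; lia.
have /negP/negPf-> : ~ K i by move=> /supK; lia.
by have /negP/negPf-> : ~ K' i by move=> /supK'; lia.
Qed.

Lemma basic_square_left_inj l l' m n k a_ll a_ll' a_gg :
  basic_square l m n k a_ll a_gg -> basic_square l' m n k a_ll' a_gg ->
  l = l' /\ a_ll = a_ll'.
Proof.
move=> /basic_square_refl sq /basic_square_refl sq'.
have [/(congr1 refl) ll' ->] := basic_square_right_inj sq sq'.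
by rewrite !reflK in ll'.
Qed.

Lemma ex_basic_square_right lambda mu nu a :
  pstrip r lambda mu -> pstrip r lambda nu ->
  exists kappa, basic_square (edge lambda) (edge mu) (edge nu) (edge kappa) a 0.
Proof.
move=> /hstripP[M [finM lmM]] /hstripP[N [finN lnN]].
have [|k [K [b [sq finK left [g [D bD]] inv]]]] :=
    square_forward hr (a0 := a) (B := - (size lambda)%:Z) lmM lnN finM finN.
  (* All bits to the left of [- size lambda] are 1, so the windows there hold [r] ones and no
     component of [a] has to vanish. *)
  move=> i c il; suff -> : ones r (edge lambda) i = r.
    by have := ltn_ord c; lia.
  rewrite -[RHS]subn0 -subSS -[RHS]muln1 -sum_nat_const_nat.
  by apply: eq_big_nat => j j1; rewrite edge_left //; lia.
have [kappa kE] := edge_strip_right finK (square_lk sq).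
exists kappa; apply/(basic_squareP hr); exists M, N, K, b; rewrite kE; split=> //.
suff -> : 0 = g by exists D.
have /finite_set_supported[B supK] := finK.
pose i := (`|D| + B + nth 0 lambda 0 + r)%N%:Z.
apply/ffunP => c; rewrite ffunE -(bD i); last by rewrite /i; lia.
rewrite inv // (_ : ones _ _ _ = 0%N) //.
apply: big1_seq => j /=; rewrite mem_index_iota => jr; rewrite /bitor.
have /negPf -> : ~~ edge lambda (i - j%:Z) by apply: edge_right; rewrite /i; lia.
by have /negP/negPf -> : ~ K (i - j%:Z) by move=> /supK; rewrite /i; lia.
Qed.

(** The reversed square starts at [kappa] with label [0]; the label it ends with is [a], and its
    last corner, reversed back, is the edge sequence of [lambda]. *)
Lemma ex_basic_square_left mu nu kappa :
  pstrip r mu kappa -> pstrip r nu kappa ->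
  exists lambda a,
    basic_square (edge lambda) (edge mu) (edge nu) (edge kappa) a 0.
Proof.
move=> /hstripP[M [finM mkM]] /hstripP[N [finN nkN]].
have [//|k [K [b [sq finK left [g right] _]]]] :=
    square_forward hr (a0 := 0) (B := 0) (strip_refl mkM) (strip_refl nkN)
      (finite_refl _ finM) (finite_refl _ finN).
  by move=> i c _ _; rewrite ffunE.
have sqr : basic_square (refl k) (edge mu) (edge nu) (edge kappa) g 0.
  rewrite -[edge mu]reflK -[edge nu]reflK -[edge kappa]reflK.
  apply: basic_square_refl; apply/(basic_squareP hr).
  by do 4!eexists; split; [exact: sq| | |].
have /(basic_squareP hr)[M1 [N1 [K1 [b1 [sq1 finK1 _ _]]]]] := sqr.
have [lambda lE] := edge_strip_left finK1 (square_lk sq1).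
by exists lambda, g; rewrite lE.
Qed.

Lemma basic_square_size_spin lambda mu nu kappa a :
  basic_square (edge lambda) (edge mu) (edge nu) (edge kappa) a 0 ->
  (psize r kappa)%:Z - (psize r nu)%:Z - (psize r mu)%:Z + (psize r lambda)%:Z
    = (weight a)%:Z /\
  pspin r mu kappa + pspin r nu kappa =
    pspin r lambda mu + pspin r lambda nu + (nweight a)%:R.
Proof.
move=> /(basic_squareP hr)[M [N [K [b [sq finK [D bD] [E bE]]]]]].
have [lm ln lk MK NK _ _] := sq.
have /finite_set_supported[C supK] := finK.
have supM : supported_in C M by move=> i /MK /supK.
have supN : supported_in C N by move=> i /NK /supK.
pose B := (`|D| + `|E| + C + r + edge_bound lambda + edge_bound mu +
           edge_bound nu + edge_bound kappa)%N.
have bl : b (- B%:Z) = a by apply: bD; rewrite /B; lia.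
have br : b B%:Z = 0 by apply: bE; rewrite /B; lia.
have moment := square_moment_wsum hr _ sq bl br.
have zero (g : nat -> nat) : (\sum_(c < r) g c * (0%R : natvec r) c = 0)%N.
  by apply: big1 => c _; rewrite ffunE muln0.
split.
  rewrite (psize_strip hr (B := B) lk supK) ?(psize_strip hr (B := B) lm supM)
    ?(psize_strip hr (B := B) ln supN); try (rewrite /B; lia).
  have := moment (fun=> 1%N); rewrite (zero (fun=> 1%N)) subr0.
  rewrite (eq_bigr (fun c => a c)) => [|c _]; last by rewrite mul1n.
  have -> : wsum B (fun i => 1%N%:Z *
      ((K i : nat)%:Z - (M i : nat)%:Z - (N i : nat)%:Z)) =
    wsum B (fun i => (K i : nat)%:Z - (M i : nat)%:Z - (N i : nat)%:Z).
    by apply: eq_wsum => i _; rewrite mul1r.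
  by rewrite !wsumB -/(weight a); lia.
have CB : (C + r <= B)%N by rewrite /B; lia.
(* Grouped as spin differences for [mu] and for [nu], the factors $K-2M$ and $K-2N$ add up to
   $2(K-M-N)$, which cancels the $\frac12$ and leaves the moment for $g(c)=c$. *)
apply/eqP; rewrite [eqbRHS]addrC -subr_eq opprD addrACA.
rewrite (spin_complement hr lm lk MK supK CB) (spin_complement hr ln lk NK supK CB).
have /= := moment id; rewrite (zero id) subr0 -/(nweight a) => mom.
rewrite -mulrDr -wsumD [(nweight a)%:R]pmulrn -mom /wsum rmorph_sum.
rewrite mulr_sumr; apply/eqP/eq_bigr => j _ /=.
rewrite rmorphM !rmorphB /= -!pmulrn; move: (height _ _ _)%:R => h.
move: (K _ : nat)%:R (M _ : nat)%:R (N _ : nat)%:R => x y z; by field.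
Qed.

End ShapeDatum.

(** * The bijections between [above] and [below] *)

Section ShapeMap.
Variables (r : nat) (hr : (0 < r)%N) (mu nu : ypartition).

Lemma ex_below (kappa : above r mu nu) : exists al : below r mu nu,
  basic_square (edge (\val al).2) (edge mu) (edge nu) (edge (\val kappa))
    (\val al).1 0.
Proof.
have [mk nk] := set_valP kappa.
have [lambda [a sq]] := ex_basic_square_left hr mk nk.
have bl : below r mu nu (a, lambda).
  by case: sq => -[lm ln _ _ _] _; split.
by exists (exist _ (a, lambda) (mem_set bl)).
Qed.

Lemma ex_above (al : below r mu nu) : exists kappa : above r mu nu,
  basic_square (edge (\val al).2) (edge mu) (edge nu) (edge (\val kappa))
    (\val al).1 0.
Proof.
have [lm ln] := set_valP al.
have [kappa sq] := ex_basic_square_right hr (\val al).1 lm ln.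
have ab : above r mu nu kappa by case: sq => -[_ _ mk nk _] _; split.
by exists (exist _ kappa (mem_set ab)).
Qed.

Lemma basic_square_below_inj (kappa : ypartition)
    (al al' : natvec r * ypartition) :
  basic_square (edge al.2) (edge mu) (edge nu) (edge kappa) al.1 0 ->
  basic_square (edge al'.2) (edge mu) (edge nu) (edge kappa) al'.1 0 ->
  al = al'.
Proof.
case: al al' => [a l] [a' l'] sq sq'.
by have [/edge_inj /= -> /= ->] := basic_square_left_inj hr sq sq'.
Qed.

End ShapeMap.

Theorem theorem5p2p7 (r : nat) (hr : (0 < r)%N) :
  exists b : shape_map r,
    [/\ is_shape_datum b,
        square_rule b,
        forall b' : shape_map r, is_shape_datum b' -> square_rule b' -> b' = b
      & forall (mu nu : ypartition) (kappa : above r mu nu)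
          (a : natvec r) (lambda : ypartition),
          \val (b mu nu kappa) = (a, lambda) ->
          pspin r mu (\val kappa) + pspin r nu (\val kappa) =
          pspin r lambda mu + pspin r lambda nu + (nweight a)%:R].
Proof.
pose b : shape_map r := fun mu nu kappa => sval (cid (ex_below hr kappa)).
have bP mu nu (kappa : above r mu nu) : basic_square
    (edge (\val (b mu nu kappa)).2) (edge mu) (edge nu) (edge (\val kappa))
    (\val (b mu nu kappa)).1 0 by rewrite /b; case: cid.
have rule : square_rule b.
  move=> mu nu kappa a lambda; split=> [E|sq].
    by have := bP mu nu kappa; rewrite E.
  exact: (basic_square_below_inj hr (al' := (a, lambda)) (bP mu nu kappa) sq).
exists b; split=> //.
- split=> [mu nu|mu nu kappa a lambda /rule/(basic_square_size_spin hr)[]//].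
  (* The inverse chooses a [kappa] completing the square; the two cancellation laws are the
     uniqueness of its right and of its left end. *)
  pose g al := sval (cid (ex_above hr al)) : above r mu nu.
  have gP al : basic_square (edge (\val al).2) (edge mu) (edge nu)
      (edge (\val (g al))) (\val al).1 0 by rewrite /g; case: cid.
  exists g => [kappa|al]; apply: val_inj.
    have := basic_square_right_inj hr (gP (b mu nu kappa)) (bP mu nu kappa).
    by case=> /edge_inj->.
  exact: (basic_square_below_inj hr (bP mu nu (g al)) (gP al)).
- move=> b' _ rule'; apply: functional_extensionality_dep => mu.
  apply: functional_extensionality_dep => nu.
  apply: functional_extensionality_dep => kappa; apply: val_inj.
  by case E : (\val (b mu nu kappa)) => [a lambda]; apply/rule'/rule.
- by move=> mu nu kappa a lambda /rule/(basic_square_size_spin hr)[].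
Qed.
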